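(* Suppose that a square-integrable process $(X_t)_{t\ge0}$ is a harness with moments $\mathbb{E}X_t=0$, $\mathbb{E}X_sX_t=s\wedge t$ for all $s,t\ge 0$, and that $X_s^2,\ X_s,\ 1$ are linearly independent for any $s>0$. Let $\mathcal{F}_t=\sigma\{X_s: s\in[0,t]\}$, and assume that for any $0<s<t$ there exist non-random $a_{ts}\ne0$, $b_{ts}$ and $c_{ts}$ such that $$\mathbb{E}(X_t^2|\mathcal{F}_s)=a_{ts}X_s^2+b_{ts}X_s+c_{ts}.$$ (i) If $s\mapsto a_{ts}$ is bounded on $(0,t)$ for some $t>0$, then there exist $b\in\mathbb{R}$ and $a\ge0$ such that, for all $0<s<t$, $$a_{ts}=\tfrac{1+ta}{1+sa},\quad b_{ts}=\tfrac{(t-s)b}{1+sa},\quad c_{ts}=\tfrac{t-s}{1+sa}.$$ (ii) If $s\mapsto a_{ts}$ is unbounded on $(0,t)$ for some $t>0$, then there exists $b\in\mathbb{R}$ such that, for all $0<s<t$, $$a_{ts}=\tfrac{t}{s},\quad b_{ts}=\tfrac{(t-s)b}{s},\quad c_{ts}=0.$$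
   Context: For a real-valued stochastic process $(X_t)_{t\ge0}$ on a probability space, $\mathcal{F}_{r,u}$ denotes the complete $\sigma$-field generated by $\{X_t: t\in[0,r]\cup[u,\infty)\}$, $0\le r<u$. A separable integrable process $(X_t)_{t\ge0}$ is a harness if for all $0\le r<s<u$ $$\mathbb{E}(X_s|\mathcal{F}_{r,u})=\tfrac{u-s}{u-r}X_r+\tfrac{s-r}{u-r}X_u.$$ Equalities between random variables are almost sure, and linear independence is understood for random variables modulo almost sure equality. *)

(* Defs.v *)
From HB Require Import structures.
From mathcomp Require Import all_boot all_order all_algebra.
From mathcomp Require Import all_classical all_reals all_analysis.
Set Implicit Arguments.
Unset Strict Implicit.
Unset Printing Implicit Defensive.
Import Order.TTheory GRing.Theory Num.Theory.
Import numFieldNormedType.Exports.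
Local Open Scope classical_set_scope.
Local Open Scope ring_scope.

(* A process (X_t)_{t >= 0} is a family indexed by all of R; every notion below
   constrains only the indices t >= 0. *)

Definition sigma_process d (T : measurableType d) (R : realType)
    (X : R -> T -> R) (I : set R) : set (set T) :=
  <<s \bigcup_(t in I) preimage_set_system setT (X t) measurable >>.

(* Completion by all subsets of P-null events, so it need not be contained in
   the sigma-algebra of T when (T, P) is not complete. *)
Definition complete_sigma_process d (T : measurableType d) (R : realType)
    (P : probability T R) (X : R -> T -> R) (I : set R) : set (set T) :=
  <<s (\bigcup_(t in I) preimage_set_system setT (X t) measurable)
      `|` [set N | P.-negligible N] >>.

(* Y is a version of E(Z | G). If A differs from a measurable set by a
   P-negligible one, the integrals over A are those of the completion of P. *)
Definition is_cond_exp d (T : measurableType d) (R : realType)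
    (P : probability T R) (G : set (set T)) (Z Y : T -> R) : Prop :=
  [/\ P.-integrable setT (EFin \o Z),
      P.-integrable setT (EFin \o Y),
      preimage_set_system setT Y measurable `<=` G &
      forall A, G A ->
        (\int[P]_(w in A) (Z w)%:E = \int[P]_(w in A) (Y w)%:E)%E].

(* Separability in the sense of Doob, relative to all closed sets. *)
Definition separable_process d (T : measurableType d) (R : realType)
    (P : probability T R) (X : R -> T -> R) : Prop :=
  exists D : set R, [/\ countable D, D `<=` [set t | 0 <= t] &
    {ae P, forall w, forall U F : set R, open U -> closed F ->
      (forall t, U t -> D t -> F (X t w)) ->
      forall t, U t -> 0 <= t -> F (X t w)}].

Definition harness d (T : measurableType d) (R : realType)
    (P : probability T R) (X : R -> {RV P >-> R}) : Prop :=
  [/\ separable_process P (fun t => X t : T -> R),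
      forall t, 0 <= t -> P.-integrable setT (EFin \o X t) &
      forall r s u, 0 <= r -> r < s -> s < u ->
        is_cond_exp P
          (complete_sigma_process P (fun t => X t : T -> R)
             (`[0, r] `|` `[u, +oo[))
          (X s)
          (fun w => (u - s) / (u - r) * X r w + (s - r) / (u - r) * X u w)].

Definition ae_lin_indep d (T : measurableType d) (R : realType)
    (P : probability T R) (n : nat) (f : n.-tuple (T -> R)) : Prop :=
  forall k : 'I_n -> R,
    {ae P, forall w, \sum_(i < n) k i * tnth f i w = 0} -> forall i, k i = 0.

(* Main.v *)
Require Import Defs.
From HB Require Import structures.
From mathcomp Require Import all_boot all_order all_algebra.
From mathcomp Require Import all_classical all_reals all_analysis.
From mathcomp Require Import measurable_realfun ring lra.
Set Implicit Arguments.
Unset Strict Implicit.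
Unset Printing Implicit Defensive.
Import Order.TTheory GRing.Theory Num.Theory.
Import numFieldNormedType.Exports.
Local Open Scope classical_set_scope.
Local Open Scope ring_scope.
(* Letting u -> oo in the harness identity shows that X is a martingale. For
   r < s < u, multiplying the identity by X_u and conditioning on F_r then gives
     E(X_s^2|F_r) = (u-s)/(u-r) X_r^2 + (s-r)/(u-r) E(X_u^2|F_r),
   so by linear independence a_ts - 1, b_ts, c_ts are linear in t - s:
   a_ts = 1 + (t-s) alpha(s), b_ts = (t-s) beta(s). The tower property
   a_us = a_ut a_ts, b_us = a_ut b_ts + b_ut turns into
   alpha(s) = alpha(t) (1 + (t-s) alpha(s)), which is solved by
   alpha(s) = A / (1 - A + s A) with A = alpha(1) in [0, 1]; s |-> a_ts is
   unbounded exactly when A = 1. All conditional identities are tested by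
   integrating over events of F_r, since fourth moments need not exist. *)

(** * Pulling a [G]-measurable factor out of a conditional expectation *)

Section pull_out.
Import HBSimple HBNNSimple.
Context d (T : measurableType d) (R : realType) (P : probability T R).
Variables (G : set (set T)) (Y Z : T -> R).
Hypotheses (GI : setI_closed G) (Gm : G `<=` measurable)
  (mY : preimage_set_system setT Y measurable `<=` G)
  (iZ : P.-integrable setT (EFin \o Z))
  (Z0 : forall A, G A -> (\int[P]_(w in A) (Z w)%:E = 0)%E).

Let mYT : measurable_fun setT Y.
Proof. by move=> _ B mB; apply/Gm/mY; exists B. Qed.

(** Each level set of [f \o Y] lies in [G], so [Z] integrates to 0 over its intersection with [A]; a
    simple function has finitely many of them. *)
Lemma integral_nnsfunM_eq0 (f : {nnsfun R >-> R}) A : G A ->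
  (\int[P]_(w in A) (f (Y w) * Z w)%:E = 0)%E.
Proof.
move=> GA; have mA := Gm GA.
pose B x : set T := Y @^-1` (f @^-1` [set x]).
have GB x : G (B x).
  apply: mY; exists (f @^-1` [set x]); last by rewrite setTI.
  exact: measurable_funPTI.
have iZB x : P.-integrable A (EFin \o (Z \_ (B x))).
  rewrite -restrict_EFin; apply/(integrable_restrict _ (Gm (GB x)))=> //.
  by apply: integrableS iZ => //; exact: measurableI mA (Gm (GB x)).
under eq_integral => w _.
  rewrite fimfunE fsbig_finite//= mulr_suml -sumEFin.
  under eq_bigr => x _.
    rewrite (_ : _%:E = x%:E * (EFin \o (Z \_ (B x))) w)%E; last first.
      rewrite /= -EFinM -mulrA patchE indicE; congr (_ * _)%:E.
      rewrite /B; have [h|h] := boolP (w \in _).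
        by rewrite mem_set ?mul1r//; exact: set_mem h.
      by rewrite memNset ?mul0r// => Bw; rewrite mem_set in h.
    over.
  over.
rewrite integral_sum//; last by move=> x; exact: integrableZl.
rewrite big1// => x _; rewrite integralZl//.
under eq_integral do rewrite -restrict_EFin.
by rewrite -integral_mkcondr Z0 ?mule0//; exact: GI.
Qed.

Lemma integral_nnfunM_eq0 (f : R -> R) A : measurable_fun setT f ->
  (forall x, 0 <= f x) ->
  P.-integrable setT (EFin \o (fun w => f (Y w) * Z w)) -> G A ->
  (\int[P]_(w in A) (f (Y w) * Z w)%:E = 0)%E.
Proof.
move=> mf f0 ifZ GA; have mA := Gm GA.
have mEf : measurable_fun [set: R] (EFin \o f) by exact/measurable_EFinP.
pose g n := nnsfun_approx measurableT mEf n.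
have mZ : measurable_fun setT Z by apply/measurable_EFinP; case/integrableP : iZ.
have [|||||_ _] := @dominated_convergence _ _ _ P A mA
  (fun n w => (g n (Y w) * Z w)%:E) (fun w => (f (Y w) * Z w)%:E)
  (fun w => `|(f (Y w) * Z w)%:E|%E).
- move=> n; apply/measurable_EFinP/measurable_funTS/measurable_funM => //.
  exact: measurableT_comp.
- apply/measurable_EFinP/measurable_funTS/measurable_funM => //.
  exact: measurableT_comp.
- apply: aeW => w _.
  under eq_fun do rewrite EFinM.
  rewrite EFinM; apply: cvgeZr => //.
  by apply: (@cvg_nnsfun_approx _ _ _ _ measurableT _ mEf) => // x _; rewrite lee_fin.
- apply: integrable_abse; exact: integrableS ifZ.
- apply: aeW => w n _ /=; rewrite lee_fin !normrM ler_wpM2r//.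
  rewrite !ger0_norm// -lee_fin /g nnsfun_approxE.
  by apply: le_approx => // x _; rewrite lee_fin.
move=> /cvg_lim <- //.
under eq_fun do rewrite (integral_nnsfunM_eq0 _ GA).
by rewrite lim_cst.
Qed.

(** The positive and negative parts of [Y] are both bounded by |Y|, so their products with [Z]
    inherit integrability from Y Z and can be treated separately. *)
Lemma integralM_eq0 A : P.-integrable setT (EFin \o (Y \* Z)) -> G A ->
  (\int[P]_(w in A) (Y w * Z w)%:E = 0)%E.
Proof.
move=> iYZ GA; have mA := Gm GA.
have mZ : measurable_fun setT Z by apply/measurable_EFinP; case/integrableP : iZ.
have bd (f : R -> R) : measurable_fun setT f -> (forall x, `|f x| <= `|x|) ->
    P.-integrable setT (EFin \o (fun w => f (Y w) * Z w)).
  move=> mf fx; apply: le_integrable iYZ => //.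
    apply/measurable_EFinP/measurable_funM => //; exact: measurableT_comp.
  by move=> w _; rewrite /= lee_fin !normrM ler_wpM2r.
have mp : measurable_fun setT (fun x : R => Num.max x 0).
  exact: measurable_maxr.
have mn : measurable_fun setT (fun x : R => Num.max (- x) 0).
  by apply: measurable_maxr => //; exact: measurable_oppr.
have ip := bd _ mp _; have im := bd _ mn _.
rewrite (_ : (\int[P]_(w in A) _ =
  \int[P]_(w in A) (((Num.max (Y w) 0 * Z w)%:E
    - (Num.max (- Y w) 0 * Z w)%:E))))%E; last first.
  apply: eq_integral => w _; rewrite -EFinB -mulrBl; congr (_ * _)%:E.
  by have [?|?] := leP (Y w) 0; have [?|?] := leP (- Y w) 0; lra.
have h1 x : `|Num.max x 0| <= `|x| :> R.
  by have [?|?] := leP x 0; rewrite ?normr0.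
have h2 x : `|Num.max (- x) 0| <= `|x| :> R.
  by have [?|?] := leP (- x) 0; rewrite ?normr0 ?normrN.
rewrite integralB//=; last 2 first.
- exact: integrableS (ip h1).
- exact: integrableS (im h2).
rewrite (integral_nnfunM_eq0 mp _ (ip h1) GA); last by move=> x; rewrite le_max lexx orbT.
rewrite (integral_nnfunM_eq0 mn _ (im h2) GA); last by move=> x; rewrite le_max lexx orbT.
by rewrite sube0.
Qed.

End pull_out.

(** * Real-valued integrals of linear combinations *)

Section Rintegral_lin.
Context d (T : measurableType d) (R : realType) (P : probability T R).

Lemma integrable_lin2 (f g : T -> R) (p q : R) :
  P.-integrable setT (EFin \o f) -> P.-integrable setT (EFin \o g) ->
  P.-integrable setT (EFin \o (fun w => p * f w + q * g w)).
Proof.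
move=> fi gi.
exact: (integrableD measurableT (integrableZl measurableT p fi)
                                (integrableZl measurableT q gi)).
Qed.

Lemma Rintegral_lin2 (f g : T -> R) (p q : R) (A : set T) : measurable A ->
  P.-integrable setT (EFin \o f) -> P.-integrable setT (EFin \o g) ->
  \int[P]_(w in A) (p * f w + q * g w) =
  p * \int[P]_(w in A) f w + q * \int[P]_(w in A) g w.
Proof.
move=> mA fi gi.
have fA : P.-integrable A (EFin \o f) by exact: integrableS fi.
have gA : P.-integrable A (EFin \o g) by exact: integrableS gi.
rewrite RintegralD//; last 2 first.
- exact: (integrableZl mA p fA).
- exact: (integrableZl mA q gA).
by rewrite !RintegralZl.
Qed.

Lemma integrable_lin3 (f g : T -> R) (p q k : R) :
  P.-integrable setT (EFin \o f) -> P.-integrable setT (EFin \o g) ->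
  P.-integrable setT (EFin \o (fun w => p * f w + q * g w + k)).
Proof.
move=> fi gi; exact: (integrableD measurableT (integrable_lin2 p q fi gi)
  (finite_measure_integrable_cst P k measurableT)).
Qed.

Lemma Rintegral_lin3 (f g : T -> R) (p q k : R) (A : set T) : measurable A ->
  P.-integrable setT (EFin \o f) -> P.-integrable setT (EFin \o g) ->
  \int[P]_(w in A) (p * f w + q * g w + k) =
  p * \int[P]_(w in A) f w + q * \int[P]_(w in A) g w + k * fine (P A).
Proof.
move=> mA fi gi; rewrite RintegralD//; last 2 first.
- by apply: integrableS (integrable_lin2 p q fi gi).
- exact: finite_measure_integrable_cst.
by rewrite Rintegral_lin2// Rintegral_cst.
Qed.

(** A real integral is the [fine] part of the extended one and is 0 also when the latter is
    infinite; integrability excludes this. *)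
Lemma Rintegral_EFin0 (f : T -> R) (A : set T) : measurable A ->
  P.-integrable setT (EFin \o f) -> \int[P]_(w in A) f w = 0 ->
  (\int[P]_(w in A) (f w)%:E = 0)%E.
Proof.
move=> mA fi f0; rewrite -[LHS]fineK; first by rewrite [fine _]f0.
by apply: integrable_fin_num => //; exact: integrableS fi.
Qed.

End Rintegral_lin.

(** * The σ-fields generated by the process *)

Section sigma_process.
Context d (T : measurableType d) (R : realType) (P : probability T R).
Variable X : R -> {RV P >-> R}.
Implicit Type I J : set R.

Let X' t : T -> R := X t.

Lemma sigma_process_measurable I : sigma_process X' I `<=` measurable.
Proof.
apply: smallest_sub; first exact: sigma_algebra_measurable.
by move=> _ [t _ [B mB <-]]; exact: measurable_funPT.
Qed.

Lemma sigma_process_setI I : setI_closed (sigma_process X' I).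
Proof.
have /(sigma_algebraP _)[|//] := smallest_sigma_algebra [set: T]
  (\bigcup_(t in I) preimage_set_system setT (X' t) measurable).
by move=> A _ x _.
Qed.

Lemma sigma_processT I : sigma_process X' I setT.
Proof.
by rewrite -setC0 -setTD; apply: sigma_algebraCD; exact: sigma_algebra0.
Qed.

Lemma sigma_processS I J : I `<=` J -> sigma_process X' I `<=` sigma_process X' J.
Proof.
move=> IJ; apply: sub_sigma_algebra2 => A [t It XA].
by exists t => //; exact: IJ.
Qed.

(** This allows the harness identity to be tested on events of the uncompleted σ-field only, all of
    which are measurable. *)
Lemma sigma_process_complete I :
  sigma_process X' I `<=` complete_sigma_process P X' I.
Proof. by apply: sub_sigma_algebra2 => A; left. Qed.

Lemma preimage_sigma_process I t (f : R -> R) : I t -> measurable_fun setT f ->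
  preimage_set_system setT (f \o X t) measurable `<=` sigma_process X' I.
Proof.
move=> It mf _ [B mB <-]; apply: sub_sigma_algebra; exists t => //.
exists (f @^-1` B) => //; rewrite -[X in measurable X]setTI; exact: mf.
Qed.

End sigma_process.

(** * First and second conditional moments of a square-integrable harness *)

Section square_integrable_harness.
Context d (T : measurableType d) (R : realType) (P : probability T R).
Variable X : R -> {RV P >-> R}.
Hypotheses (X_L2 : forall t, 0 <= t -> (X t : T -> R) \in Lfun P 2%:E)
  (X_harness : harness X)
  (X_var : forall t, 0 <= t -> \int[P]_w (X t w ^+ 2) = t).

Let F r := sigma_process (fun t => X t : T -> R) `[0, r].

Let mF r : F r `<=` measurable. Proof. exact: sigma_process_measurable. Qed.

Lemma harness_integrable t : 0 <= t -> P.-integrable setT (EFin \o X t).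
Proof. by case: X_harness => _ + _; exact. Qed.

Lemma harness_integrableM s t : 0 <= s -> 0 <= t ->
  P.-integrable setT (EFin \o (fun w => X s w * X t w)).
Proof.
by move=> s0 t0; apply/Lfun1_integrable; apply: Lfun2_mul_Lfun1; exact: X_L2.
Qed.

Lemma harness_integrableX t : 0 <= t ->
  P.-integrable setT (EFin \o (fun w => X t w ^+ 2)).
Proof. by move=> t0; exact: Lfun2_integrable_sqr (X_L2 t0). Qed.

Lemma Rintegral_cond_exp G Z Y A : is_cond_exp P G Z Y -> G A ->
  \int[P]_(w in A) Z w = \int[P]_(w in A) Y w.
Proof. by case=> _ _ _ h GA; rewrite /Rintegral h. Qed.

Lemma harness_Rintegral r s u A : 0 <= r -> r < s -> s < u ->
  sigma_process (fun t => X t : T -> R) (`[0, r] `|` `[u, +oo[) A ->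
  \int[P]_(w in A) X s w =
  (u - s) / (u - r) * \int[P]_(w in A) X r w +
  (s - r) / (u - r) * \int[P]_(w in A) X u w.
Proof.
move=> r0 rs su GA; have [_ _ hX] := X_harness.
rewrite (Rintegral_cond_exp (hX _ _ _ r0 rs su)); last first.
  exact: sigma_process_complete.
rewrite Rintegral_lin2 //.
- exact: sigma_process_measurable GA.
- exact: harness_integrable.
- by apply: harness_integrable; lra.
Qed.

(** This bounds E|X_t| by a multiple of sqrt t without square roots: the optimal [e] would be 1 /
    sqrt t. The free parameter is fixed later to make the linear growth in [t] as slow as needed. *)
Lemma normr_Rintegral_harness_le e t A : 0 < e -> 0 <= t -> measurable A ->
  `|\int[P]_(w in A) X t w| <= (e * t + e^-1) / 2.
Proof.
move=> e0 t0 mA; have iX := harness_integrable t0.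
have iXA : P.-integrable A (EFin \o X t) by exact: integrableS iX.
have iN : P.-integrable setT (EFin \o (fun w => `|X t w|)).
  exact: integrable_norm.
have iX2 := harness_integrableX t0.
apply: le_trans (le_normr_Rintegral mA iXA) _.
apply: (@le_trans _ _ (\int[P]_w `|X t w|)).
  rewrite /Rintegral fine_le//.
  - by apply: integrable_fin_num => //; exact: integrableS iN.
  - exact: integrable_fin_num.
  - by apply: ge0_subset_integral => //; case/integrableP: iN.
apply: (@le_trans _ _ (\int[P]_w (e / 2 * X t w ^+ 2 + 0 * X t w + e^-1 / 2))).
  apply: le_Rintegral => //; first exact: integrable_lin3.
  move=> w _; rewrite -[X t w ^+ 2]real_normK ?num_real//.
  (* AM-GM: |x| <= (e x^2 + 1 / e) / 2 *)
  have : 0 <= (e * `|X t w| - 1) ^+ 2 / (2 * e).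
    by rewrite divr_ge0 ?sqr_ge0// mulr_ge0// ltW.
  have -> : (e * `|X t w| - 1) ^+ 2 / (2 * e) =
    e / 2 * `|X t w| ^+ 2 - `|X t w| + e^-1 / 2 by field; lra.
  lra.
rewrite Rintegral_lin3// X_var// probability_setT/=; lra.
Qed.

Lemma harness_martingale r t A : 0 <= r -> r <= t -> F r A ->
  \int[P]_(w in A) X t w = \int[P]_(w in A) X r w.
Proof.
move=> r0; rewrite le_eqVlt => /predU1P[->//|rt] FA; have mA := mF FA.
apply/eqP; rewrite -subr_eq0; apply/negPn/negP => D0.
set m := fun u => \int[P]_(w in A) X u w in D0.
(* |D| (u - r) is at most (t - r) (|m u| + |m r|), and |m u| = O(sqrt u): taking
   e = |D| / (t - r) in the bound on |m u| contradicts u -> oo. *)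
pose D := m t - m r.
have {}D0 : 0 < `|D| by rewrite normr_gt0.
have tr0 : 0 < t - r by rewrite subr_gt0.
pose e := `|D| / (t - r).
have e0 : 0 < e by rewrite divr_gt0.
pose K := (t - r) * (e^-1 / 2 + `|m r|).
have K0 : 0 <= K.
  have ei0 : 0 < e^-1 by rewrite invr_gt0.
  by apply: mulr_ge0; have := normr_ge0 (m r); lra.
have bnd u : t < u -> `|D| * (u - r) <= `|D| * u / 2 + K.
  move=> tu; have ur0 : 0 < u - r by lra.
  have FuA : sigma_process (fun t => X t : T -> R) (`[0, r] `|` `[u, +oo[) A.
    by apply: sigma_processS FA => x; left.
  have Du : D * (u - r) = (t - r) * (m u - m r).
    rewrite /D {1}/m (harness_Rintegral r0 rt tu FuA) -/(m r) -/(m u).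
    by field; lra.
  have mu : `|m u| <= (e * u + e^-1) / 2.
    by apply: normr_Rintegral_harness_le => //; lra.
  rewrite -[u - r]gtr0_norm// -normrM Du normrM gtr0_norm// /K.
  have -> : `|D| = e * (t - r) by rewrite /e mulfVK// gt_eqF.
  have : (t - r) * `|m u - m r| <= (t - r) * ((e * u + e^-1) / 2 + `|m r|).
    rewrite ler_pM2l//; have := ler_normB (m u) (m r); lra.
  lra.
(* With this [u], |D| (u - r) exceeds the bound in [bnd] by exactly |D| (t + 1) / 2 > 0. *)
pose u := t + r * 2 + 2 * K / `|D| + 1.
have q0 : 0 <= K / `|D| by rewrite divr_ge0.
have := bnd u.
have -> : `|D| * (u - r) = `|D| * u / 2 + `|D| * (t + 1) / 2 + K.
  by rewrite /u; field; lra.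
have : 0 < `|D| * (t + 1) by rewrite mulr_gt0//; lra.
have : t < u by rewrite /u; lra.
by move=> tu + /(_ tu); lra.
Qed.

(** By the martingale property X_u - X_s integrates to 0 over events of F_s, and the F_s-measurable
    factor X_s can be pulled out. *)
Lemma harness_RintegralM s u A : 0 <= s -> s <= u -> F s A ->
  \int[P]_(w in A) (X s w * X u w) = \int[P]_(w in A) (X s w ^+ 2).
Proof.
move=> s0 su FA; have u0 : 0 <= u by lra.
have iZ : P.-integrable setT (EFin \o (fun w => 1 * X u w + (- 1) * X s w)).
  by apply: integrable_lin2; exact: harness_integrable.
have iYZ : P.-integrable setT
    (EFin \o (fun w => X s w * (1 * X u w + (- 1) * X s w))).
  have -> : (fun w => X s w * (1 * X u w + (- 1) * X s w)) =
    (fun w => 1 * (X s w * X u w) + (- 1) * (X s w * X s w)).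
    by apply/funext => w; ring.
  by apply: integrable_lin2; exact: harness_integrableM.
have mX : preimage_set_system setT (X s) measurable `<=` F s.
  apply: (@preimage_sigma_process _ _ _ P X `[0, s] s id); last exact: measurable_id.
  by rewrite /= in_itv/= s0 lexx.
have := @integralM_eq0 _ _ _ P (F s) (X s) _ (@sigma_process_setI _ _ _ P X `[0, s])
  (@mF s) mX iZ _ A iYZ FA.
move=> H; have {}H : \int[P]_(w in A) (X s w * (1 * X u w + -1 * X s w)) = 0.
  rewrite /Rintegral H// => B FB; apply: Rintegral_EFin0 => //.
    exact: mF FB.
  rewrite Rintegral_lin2 ?(harness_martingale s0 su FB); [lra| | |].
  - exact: mF FB.
  - exact: harness_integrable.
  - exact: harness_integrable.
have E : {in A, (fun w => X s w * (1 * X u w + -1 * X s w)) =1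
    (fun w => 1 * (X s w * X u w) + (- 1) * (X s w ^+ 2))}.
  by move=> w _ /=; ring.
move: H; rewrite (eq_Rintegral P E).
rewrite Rintegral_lin2//; [lra|exact: mF FA| |].
- exact: harness_integrableM.
- exact: harness_integrableX.
Qed.


(** X_u is measurable for the past of [r] together with the future of [u], so it may multiply the
    harness identity. The products X_s X_u and X_r X_u then turn into X_s^2 and X_r^2 by
    [harness_RintegralM]. *)
Lemma harness_RintegralX r s u A : 0 <= r -> r < s -> s < u -> F r A ->
  \int[P]_(w in A) (X s w ^+ 2) =
  (u - s) / (u - r) * \int[P]_(w in A) (X r w ^+ 2) +
  (s - r) / (u - r) * \int[P]_(w in A) (X u w ^+ 2).
Proof.
move=> r0 rs su FA; have s0 : 0 <= s by lra.
have u0 : 0 <= u by lra.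
pose p := (u - s) / (u - r); pose q := (s - r) / (u - r).
(* The error of the harness prediction of X_s; the factors 1 and -1 give it the shape that
   [Rintegral_lin2] expects. *)
pose Z w := 1 * X s w + (- 1) * (p * X r w + q * X u w).
have iZ : P.-integrable setT (EFin \o Z).
  apply: integrable_lin2; first exact: harness_integrable.
  by apply: integrable_lin2; exact: harness_integrable.
have YZE : X u \* Z = (fun w => 1 * (X s w * X u w) +
    (- 1) * (p * (X r w * X u w) + q * (X u w ^+ 2))).
  by apply/funext => w; rewrite /Z /=; ring.
have iRU := integrable_lin2 p q (harness_integrableM r0 u0)
  (harness_integrableX u0).
have iSU := harness_integrableM s0 u0.
have iYZ : P.-integrable setT (EFin \o (X u \* Z)).
  by rewrite YZE; exact: integrable_lin2.
pose J : set R := `[0, r] `|` `[u, +oo[.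
have mX : preimage_set_system setT (X u) measurable `<=`
    sigma_process (fun t => X t : T -> R) J.
  apply: (@preimage_sigma_process _ _ _ P X J u id); last exact: measurable_id.
  by right; rewrite /= in_itv/= lexx.
have GA : sigma_process (fun t => X t : T -> R) J A.
  by apply: sigma_processS FA => x; left.
have mA := mF FA.
have H : (\int[P]_(w in A) (X u w * Z w)%:E = 0)%E.
  apply: (@integralM_eq0 _ _ _ P _ (X u) Z (@sigma_process_setI _ _ _ P X J)
    (@sigma_process_measurable _ _ _ P X J) mX iZ _ A iYZ GA) => B GB.
  have mB := sigma_process_measurable GB.
  apply: Rintegral_EFin0 => //.
  rewrite Rintegral_lin2//; last 2 first.
  - exact: harness_integrable.
  - by apply: integrable_lin2; exact: harness_integrable.
  rewrite Rintegral_lin2//; [|exact: harness_integrable..].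
  by rewrite (harness_Rintegral r0 rs su GB) -/p -/q; ring.
have {H} : \int[P]_(w in A) (X u \* Z) w = 0 by rewrite /Rintegral H.
rewrite YZE Rintegral_lin2// Rintegral_lin2//; last 2 first.
- exact: harness_integrableM.
- exact: harness_integrableX.
rewrite (harness_RintegralM s0 (ltW su)); last first.
  by apply: sigma_processS FA; apply: subset_itvl; rewrite bnd_simp ltW.
rewrite (harness_RintegralM r0 _ FA); last by lra.
by rewrite -/p -/q; lra.
Qed.

Hypothesis X_indep : forall s, 0 < s ->
  ae_lin_indep P [tuple (fun w => X s w ^+ 2); (fun w => X s w); (fun=> 1)].

Lemma quadratic_eq0 s p q k : 0 < s ->
  (forall A, F s A -> p * \int[P]_(w in A) (X s w ^+ 2) +
    q * \int[P]_(w in A) X s w + k * fine (P A) = 0) ->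
  [/\ p = 0, q = 0 & k = 0].
Proof.
(* The truncation g of f makes g(X_s) f(X_s) integrable without fourth
   moments, and g f vanishes only where f does. *)
move=> s0 H; pose f (x : R) := p * x ^+ 2 + q * x + k.
pose g (x : R) := Num.max (-1) (Num.min 1 (f x)).
have mf : measurable_fun [set: R] f.
  apply: measurable_funD => //; apply: measurable_funD.
    by apply: measurable_funM => //; exact: measurable_funX.
  exact: measurable_funM.
have mg : measurable_fun [set: R] g.
  by apply: measurable_maxr => //; exact: measurable_minr.
have iX2 := harness_integrableX (ltW s0).
have iX := harness_integrable (ltW s0).
have iZ : P.-integrable setT (EFin \o (f \o X s)).
  exact: integrable_lin3.
have gf0 x : 0 <= g x * f x.
  rewrite /g; have [f1|f1] := leP 1 (f x).
    by have [f2|f2] := leP (-1) _; nra.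
  by have [f2|f2] := leP (-1) _; nra.
have gf x : g x * f x = 0 -> f x = 0.
  move=> /eqP; rewrite mulf_eq0 => /orP[|/eqP//].
  rewrite /g; have [f1|f1] := leP 1 (f x).
    by have [f2|f2] := leP (-1) _ => /eqP; lra.
  by have [f2|f2] := leP (-1) _ => /eqP; lra.
have gb x : `|g x| <= 1.
  rewrite /g; have [f1|f1] := leP 1 (f x).
    by have [f2|f2] := leP (-1) _; rewrite ler_norml; lra.
  by have [f2|f2] := leP (-1) _; rewrite ler_norml; lra.
have mfX : measurable_fun setT (f \o X s) by exact: measurableT_comp.
have mgX : measurable_fun setT (g \o X s) by exact: measurableT_comp.
have iYZ : P.-integrable setT (EFin \o ((g \o X s) \* (f \o X s))).
  apply: le_integrable iZ => //.
    by apply/measurable_EFinP; exact: measurable_funM.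
  by move=> w _; rewrite /= lee_fin normrM ler_piMl.
have mX : preimage_set_system setT (g \o X s) measurable `<=` F s.
  apply: (@preimage_sigma_process _ _ _ P X `[0, s] s g) => //.
  by rewrite /= in_itv/= ltW ?lexx.
(* By hypothesis f(X_s) has zero integral over every event of F_s, so it may be tested against its
   own truncation; the product is nonnegative, hence zero almost surely. *)
have I0 : (\int[P]_(w in setT) (g (X s w) * f (X s w))%:E = 0)%E.
  apply: (@integralM_eq0 _ _ _ P _ (g \o X s) (f \o X s)
    (@sigma_process_setI _ _ _ P X _) (@mF s) mX iZ _ setT iYZ) => [B FB|].
    apply: Rintegral_EFin0 => //; first exact: mF FB.
    by rewrite Rintegral_lin3// ?H//; exact: mF FB.
  exact: sigma_processT.
have ae0 : {ae P, forall w, f (X s w) = 0}.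
  have /(ae_eq_integral_abs P measurableT) h :
    measurable_fun setT (fun w => (g (X s w) * f (X s w))%:E).
    by apply/measurable_EFinP; exact: measurable_funM.
  have /h : (\int[P]_(w in setT) `|(g (X s w) * f (X s w))%:E| = 0)%E.
    by rewrite -[RHS]I0; apply: eq_integral => w _; rewrite gee0_abs// lee_fin.
  by apply: filterS => w /(_ I) [] /gf.
pose c := tnth [tuple p; q; k].
have /(X_indep s0) c0 : {ae P, forall w, \sum_(i < 3) c i * tnth
    [tuple (fun w => X s w ^+ 2); (fun w => X s w); (fun=> 1)] i w = 0}.
  apply: filterS ae0 => w fw.
  by rewrite !big_ord_recl big_ord0 /c /tnth /= mulr1 addr0 addrA.
split; [exact: (c0 ord0)|exact: (c0 (lift ord0 ord0))|].
exact: (c0 (lift ord0 (lift ord0 ord0))).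
Qed.

End square_integrable_harness.

(** * Solving the functional equations for the coefficients *)

Section coefficients.
Context (R : realType) (a b c : R -> R -> R).
Hypotheses (a_harness : forall r s u, 0 < r -> r < s -> s < u ->
    a s r = (u - s) / (u - r) + (s - r) / (u - r) * a u r)
  (b_harness : forall r s u, 0 < r -> r < s -> s < u ->
    b s r = (s - r) / (u - r) * b u r)
  (a_tower : forall s t u, 0 < s -> s < t -> t < u -> a u s = a u t * a t s)
  (b_tower : forall s t u, 0 < s -> s < t -> t < u ->
    b u s = a u t * b t s + b u t)
  (c_mean : forall s t, 0 < s -> s < t -> c t s = t - s * a t s).

(** The harness relations make a_ts - 1 and b_ts proportional to t - s for fixed [s]. The slopes are
    therefore read off at t = s + 1, by interpolation for smaller [t] and extrapolation for larger
    [t]. *)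
Lemma coefficients_affine : exists al be : R -> R, forall s t, 0 < s -> s < t ->
  a t s = 1 + (t - s) * al s /\ b t s = (t - s) * be s.
Proof.
exists (fun s => a (s + 1) s - 1), (fun s => b (s + 1) s) => s t s0 st.
have [t1|t1|->] := ltrgtP t (s + 1).
- by rewrite (a_harness s0 st t1) (b_harness s0 st t1); split; field; lra.
- have s1 : s < s + 1 by lra.
  rewrite (a_harness s0 s1 t1) (b_harness s0 s1 t1).
  by split; field; lra.
- by split; ring.
Qed.

Lemma coefficients_closed_form : exists A B : R, 0 <= A <= 1 /\
  forall s t, 0 < s -> s < t ->
  [/\ 0 < 1 - A + s * A,
      a t s = (1 - A + t * A) / (1 - A + s * A),
      b t s = (t - s) * B / (1 - A + s * A) &
      c t s = (t - s) * (1 - A) / (1 - A + s * A)].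
Proof.
have [al [be ab]] := coefficients_affine.
(* The tower relation at s < t < t + 1, where the last step has a_ut = 1 + [al t]. *)
have al_rec s t : 0 < s -> s < t -> al s = al t * (1 + (t - s) * al s).
  move=> s0 st; have t0 : 0 < t by lra.
  have t1 : t < t + 1 by lra.
  have s1 : s < t + 1 by lra.
  have := a_tower s0 st t1.
  rewrite (ab _ _ s0 s1).1 (ab _ _ s0 st).1 (ab _ _ t0 t1).1; lra.
have be_rec s t : 0 < s -> s < t -> be s = al t * (t - s) * be s + be t.
  move=> s0 st; have t0 : 0 < t by lra.
  have t1 : t < t + 1 by lra.
  have s1 : s < t + 1 by lra.
  have := b_tower s0 st t1.
  rewrite (ab _ _ s0 s1).2 (ab _ _ s0 st).2 (ab _ _ t0 t1).2 (ab _ _ t0 t1).1.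
  lra.
pose A := al 1; pose B := be 1; exists A, B.
(* Cross-multiplied, since the denominator is not yet known to be nonzero. The recursion is used
   between [s] and 1, in whichever order they come. *)
have alE s : 0 < s -> al s * (1 - A + s * A) = A.
  move=> s0; have [s1|s1|->] := ltrgtP s 1; last by rewrite /A; ring.
    by have := al_rec _ _ s0 s1; rewrite -/A; lra.
  by have := al_rec _ _ ltr01 s1; rewrite -/A; lra.
have beE s : 0 < s -> be s * (1 - A + s * A) = B.
  move=> s0; have [s1|s1|->] := ltrgtP s 1; last by rewrite /B; ring.
    by have := be_rec _ _ s0 s1; rewrite -/A -/B; lra.
  (* For s > 1 the recursion starting at 1 still involves [al s], which [alE] eliminates. *)
  have := be_rec _ _ ltr01 s1; rewrite -/B => H.
  have -> : be s = B - al s * (s - 1) * B by lra.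
  have -> : (B - al s * (s - 1) * B) * (1 - A + s * A) =
    B * ((1 - A + s * A) - (al s * (1 - A + s * A)) * (s - 1)) by ring.
  by rewrite alE//; ring.
(* A zero denominator would force A = 0 by [alE], and then the denominator would be 1. *)
have D0 s : 0 < s -> 1 - A + s * A != 0.
  move=> s0; apply/eqP => D0; have := alE _ s0.
  by rewrite D0 mulr0 => A0; move: D0; rewrite -A0; lra.
have A01 : 0 <= A <= 1.
  (* otherwise 1 - A + s A vanishes at s = (A - 1) / A > 0 *)
  have [//|Abad] := boolP (0 <= A <= 1).
  have A0 : A != 0 by apply: contra Abad => /eqP ->; rewrite lexx ler01.
  have q0 : 0 < (A - 1) / A.
    move: Abad; rewrite negb_and -!ltNge => /orP[An|A1].
      by rewrite nmulr_lgt0 ?invr_lt0//; lra.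
    by rewrite divr_gt0//; lra.
  by have /negP[] := D0 _ q0; apply/eqP; field.
split=> // s t s0 st; have Ds := D0 _ s0.
have /andP[A0 A1] := A01.
have Dpos : 0 < 1 - A + s * A.
  rewrite lt_neqAle eq_sym Ds/=; nra.
have alq : al s = A / (1 - A + s * A) by rewrite -[in LHS](mulfK Ds (al s)) alE.
have beq : be s = B / (1 - A + s * A) by rewrite -[in LHS](mulfK Ds (be s)) beE.
split=> //.
- by rewrite (ab _ _ s0 st).1 alq; field.
- by rewrite (ab _ _ s0 st).2 beq; field.
- by rewrite c_mean// (ab _ _ s0 st).1 alq; field.
Qed.

End coefficients.

(** * The bounded and unbounded cases *)

Lemma bounded_near_0_div (R : realType) (t : R) : 0 < t ->
  ~ [bounded (t / s : R^o) | s in `]0, t[ ].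
Proof.
move=> t0 [M [Mr HM]].
(* [K] exceeds the bound |M| + 1 and is the value of t / s at s = t / K; K >= 2 keeps this point
   below [t]. *)
pose K := `|M| + 2.
have K2 : 2 <= K by rewrite /K; have := normr_ge0 M; lra.
have MK : M < `|M| + 1 by have := ler_norm M; lra.
have := HM _ MK (t / K); rewrite /= in_itv/= => H.
have K0 : 0 < K by lra.
have /H : 0 < t / K < t.
  rewrite divr_gt0//= ltr_pdivrMr//; nra.
have -> : t / (t / K) = K by field; lra.
by rewrite gtr0_norm// /K; lra.
Qed.

Theorem proposition4p1 (d : measure_display) (T : measurableType d)
    (R : realType) (P : probability T R) (X : R -> {RV P >-> R})
    (a b c : R -> R -> R)
    (X_L2 : forall t, 0 <= t -> (X t : T -> R) \in Lfun P 2%:E)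
    (X_harness : harness X)
    (X_mean : forall t, 0 <= t -> ('E_P[X t] = 0)%E)
    (X_cov : forall s t, 0 <= s -> 0 <= t ->
      ('E_P[(fun w => X s w * X t w)%R] = (Num.min s t)%:E)%E)
    (X_indep : forall s, 0 < s ->
      ae_lin_indep P [tuple (fun w => X s w ^+ 2); (fun w => X s w); (fun=> 1)])
    (a_neq0 : forall s t, 0 < s -> s < t -> a t s != 0)
    (X_quad : forall s t, 0 < s -> s < t ->
      is_cond_exp P (sigma_process (fun t => X t : T -> R) `[0, s])
        (fun w => X t w ^+ 2)
        (fun w => a t s * X s w ^+ 2 + b t s * X s w + c t s)) :
  ((exists t : R, 0 < t /\ [bounded (a t s : R^o) | s in `]0, t[ ]) ->
    exists b0 a0 : R, 0 <= a0 /\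
      forall s t, 0 < s -> s < t ->
        [/\ a t s = (1 + t * a0) / (1 + s * a0),
            b t s = (t - s) * b0 / (1 + s * a0) &
            c t s = (t - s) / (1 + s * a0)])
  /\
  ((exists t : R, 0 < t /\ ~ [bounded (a t s : R^o) | s in `]0, t[ ]) ->
    exists b0 : R,
      forall s t, 0 < s -> s < t ->
        [/\ a t s = t / s,
            b t s = (t - s) * b0 / s &
            c t s = 0]).
Proof.
have X_var t : 0 <= t -> \int[P]_w (X t w ^+ 2) = t.
  move=> t0; have := X_cov _ _ t0 t0; rewrite minxx unlock => E.
  by rewrite /Rintegral; under eq_integral do rewrite expr2; rewrite E.
have iX t : 0 <= t -> P.-integrable setT (EFin \o X t).
  exact: harness_integrable.
have iX2 t : 0 <= t -> P.-integrable setT (EFin \o (fun w => X t w ^+ 2)).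
  by move=> t0; exact: (harness_integrableX X_L2).
pose F s := sigma_process (fun t => X t : T -> R) `[0, s].
have quad s t A : 0 < s -> s < t -> F s A -> \int[P]_(w in A) (X t w ^+ 2) =
    a t s * \int[P]_(w in A) (X s w ^+ 2) + b t s * \int[P]_(w in A) X s w +
    c t s * fine (P A).
  move=> s0 st FA; rewrite (Rintegral_cond_exp (X_quad _ _ s0 st) FA).
  apply: Rintegral_lin3; last 2 first.
  - by apply: iX2; lra.
  - by apply: iX; lra.
  - exact: sigma_process_measurable FA.
(* Two expressions for E(X_s^2|F_r) are compared: the quadratic one directly, and the harness one
   with E(X_u^2|F_r) expanded. *)
have harn r s u : 0 < r -> r < s -> s < u ->
    [/\ a s r - ((u - s) / (u - r) + (s - r) / (u - r) * a u r) = 0,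
        b s r - (s - r) / (u - r) * b u r = 0 &
        c s r - (s - r) / (u - r) * c u r = 0].
  move=> r0 rs su; apply: (quadratic_eq0 X_L2 X_harness X_indep r0) => A FA.
  have := harness_RintegralX X_L2 X_harness X_var (ltW r0) rs su FA.
  by rewrite (quad r s)// (quad r u)//; lra.
(* E(X_u^2|F_s) is computed directly and through F_t; the martingale property handles the linear
   term b_ut X_t. *)
have tower s t u : 0 < s -> s < t -> t < u ->
    [/\ a u s - a u t * a t s = 0,
        b u s - (a u t * b t s + b u t) = 0 &
        c u s - (a u t * c t s + c u t) = 0].
  move=> s0 st tu; apply: (quadratic_eq0 X_L2 X_harness X_indep s0) => A FA.
  have := quad s u A s0 (lt_trans st tu) FA.
  have FtA : F t A.
    by apply: sigma_processS FA; apply: subset_itvl; rewrite bnd_simp ltW.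
  rewrite (quad t u)//; last by lra.
  rewrite (quad s t)// (harness_martingale X_L2 X_harness X_var _ _ FA); lra.
(* Taking full expectations gives t = a_ts s + c_ts. *)
have cmean s t : 0 < s -> s < t -> c t s = t - s * a t s.
  move=> s0 st; have := quad s t setT s0 st (@sigma_processT _ _ _ P X _).
  have mX : \int[P]_w X s w = 0.
    by have := X_mean _ (ltW s0); rewrite unlock /Rintegral => ->.
  rewrite mX !X_var ?probability_setT/=; lra.
have [||||//|A [B [/andP[A0 A1] abc]]] := @coefficients_closed_form R a b c.
- by move=> r s u r0 rs su; have [/subr0_eq] := harn r s u r0 rs su.
- by move=> r s u r0 rs su; have [_ /subr0_eq] := harn r s u r0 rs su.
- by move=> s t u s0 st tu; have [/subr0_eq] := tower s t u s0 st tu.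
- by move=> s t u s0 st tu; have [_ /subr0_eq] := tower s t u s0 st tu.
split=> [[t [t0 bt]]|[t [t0 ubt]]].
- have {}A1 : A < 1.
    rewrite lt_neqAle A1 andbT; apply/eqP => A_1.
    apply: (bounded_near_0_div t0); case: bt => M [Mr HM].
    exists M; split=> // x Mx s /[dup] st; rewrite /= in_itv/= => /andP[s0 st'].
    have := HM x Mx s st => /=; have [_ -> _ _] := abc s t s0 st'.
    by rewrite A_1 subrr !add0r !mulr1.
  (* Numerators and denominators of the closed form are divided by 1 - A > 0. *)
  exists (B / (1 - A)), (A / (1 - A)); split.
    by rewrite divr_ge0//; lra.
  move=> s u s0 su; have [D0 -> -> ->] := abc s u s0 su.
  have nz : 1 - A + s * A != 0 by rewrite gt_eqF.
  by split; field; rewrite ?nz ?andbT; lra.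
- have A_1 : A = 1.
    apply: contra_notP ubt => A_neq1.
    have {}A1 : A < 1 by rewrite lt_neqAle A1 andbT; exact/eqP.
    (* The denominator 1 - A + s A is at least 1 - A > 0, so the value of the closed form at s = 0
       is an upper bound. *)
    exists ((1 - A + t * A) / (1 - A)); split; first exact: num_real.
    move=> x Mx s; rewrite /= in_itv/= => /andP[s0 st].
    have [D0 -> _ _] := abc s t s0 st.
    have tA : 0 <= t * A by rewrite mulr_ge0// ltW.
    have sA : 0 <= s * A by rewrite mulr_ge0// ltW.
    rewrite ger0_norm; last by rewrite divr_ge0//; lra.
    apply: le_trans (ltW Mx); rewrite ler_pM2l; last by lra.
    by rewrite lef_pV2 ?posrE; lra.
  exists B => s u s0 su; have [_ -> -> ->] := abc s u s0 su.
  by rewrite A_1 subrr !add0r !mulr1 mulr0 mul0r.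
Qed.
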